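(* Let $f\in\mathbb{R}[x_0,\dots,x_n]$ be a strictly positive definite form. Then there exists an odd number $m\ge 1$ such that $f^m$ is a sum of squares of forms in $\mathbb{R}[x_0,\dots,x_n]$.
   Context: A form is a homogeneous polynomial. A form $f\in\mathbb{R}[x_0,\dots,x_n]$ is strictly positive definite if $f(\xi)>0$ for all $\xi\in\mathbb{R}^{n+1}\setminus\{(0,\dots,0)\}$. *)

(* Defs.v *)
From mathcomp Require Import all_boot all_order all_algebra.
From mathcomp Require Import reals.
From mathcomp Require Import mpoly.

Set Implicit Arguments.
Unset Strict Implicit.
Unset Printing Implicit Defensive.

Import Order.TTheory GRing.Theory Num.Theory.
Local Open Scope ring_scope.

(* The zero polynomial is homogeneous of every degree, hence a form. *)
Definition is_form (R : realType) (n : nat) (f : {mpoly R[n.+1]}) : Prop :=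
  exists d : nat, f \is d.-homog.

Definition strictly_posdef (R : realType) (n : nat) (f : {mpoly R[n.+1]}) : Prop :=
  forall xi : 'rV[R]_n.+1, xi != 0 -> 0 < f.@[xi 0].

Definition sos_of_forms (R : realType) (n : nat) (f : {mpoly R[n.+1]}) : Prop :=
  exists2 gs : seq {mpoly R[n.+1]},
    {in gs, forall g, is_form g} & f = \sum_(g <- gs) g ^+ 2.

(* Main.v *)
Require Import Defs.
From mathcomp Require Import all_boot all_order all_algebra.
From mathcomp Require Import reals.
From mathcomp Require Import ring lra zify.
From mathcomp Require topology normedtype derive.

(* Let [f] have degree [2d], [sigma = sum x_i^2], [s = sigma^d] and [u = s / f].

   Positivity of [f] gives [N] with [N f - s] positive definite, and then
   [sigma^r (N f - s)] is a sum of squares for some [r]: with [y]-variables standing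
   for the squares [(x_i + x_j)^2] and [(x_i - x_j)^2], every form of even degree in
   [x] lifts to a form in [y]; adding a multiple of the squared equations of the locus
   [{ y(x) }] makes the lift positive on the whole simplex, and by Polya's theorem its
   product with a power of [sum y] has nonnegative coefficients.

   Let [P] and [T] be the cones of fractions (sum of squares) / (power of [f]) with
   even, respectively odd, exponent; the goal is [1 \in T]. In terms of [u] the above
   says that [u^(2i+1) (N - u)] lies in [P], and comparing monomials with [sigma]
   gives [1 + c u \in T] and [c^2 u^2 - 1 \in P]. These bound a suitable power [V] of
   [u^2] from above and away from 0 modulo [P]. Expanding [1 = V q(V) + (1 - V / M)^K]
   and rewriting the small remainder with [1 + c u \in T] yields [1 \in T]. *)

Set Implicit Arguments.
Unset Strict Implicit.
Unset Printing Implicit Defensive.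

Import Order.TTheory GRing.Theory Num.Theory.
Local Open Scope ring_scope.

(** * Positive continuous functions on compact sets *)

Section Compactness.
Import classical_sets topology normedtype derive.
Import numFieldNormedType.Exports.
Local Open Scope classical_set_scope.

(* Sealing [continuous] in an inductive type keeps topological notions out of the
   types of the lemmas that are used once the imports of this section are gone. *)
Variant cts (R : realType) k (F : 'rV[R]_k -> R) : Prop := Cts of continuous F.

Lemma cts_cst (R : realType) k (c : R) : cts (fun _ : 'rV[R]_k => c).
Proof. by split; exact: cst_continuous. Qed.

Lemma cts_coord (R : realType) k i : cts (fun v : 'rV[R]_k => v 0 i).
Proof. by split; exact: coord_continuous. Qed.

Lemma ctsD (R : realType) k (F G : 'rV[R]_k -> R) :
  cts F -> cts G -> cts (fun v => F v + G v).
Proof. by move=> [cF] [cG]; split=> v; apply: continuousD; [exact: cF|exact: cG]. Qed.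

Lemma ctsM (R : realType) k (F G : 'rV[R]_k -> R) :
  cts F -> cts G -> cts (fun v => F v * G v).
Proof. by move=> [cF] [cG]; split=> v; apply: continuousM; [exact: cF|exact: cG]. Qed.

(** The conditions [H j v <= 0] are closed, so inside the cube [[-1, 1]^k] they cut out a compact
    set, on which [F] attains its minimum. *)
Lemma cts_lower_bound (R : realType) k (J : Type) (F : 'rV[R]_k -> R)
    (H : J -> 'rV[R]_k -> R) :
  cts F -> (forall j, cts (H j)) ->
  (forall v : 'rV_k, (forall i, `|v 0 i| <= 1) -> (forall j, H j v <= 0) ->
     0 < F v) ->
  exists2 e, 0 < e & forall v : 'rV_k,
    (forall i, `|v 0 i| <= 1) -> (forall j, H j v <= 0) -> e <= F v.
Proof.
move=> [cF] cH Fpos.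
pose box := [set v : 'rV[R]_k | forall i, (`[-1, 1]%classic : set R) (v 0 i)].
pose K : set 'rV[R]_k := box `&` (\bigcap_(j in setT) [set v | H j v <= 0]).
have KP v : K v <-> (forall i, `|v 0 i| <= 1) /\ (forall j, H j v <= 0).
  split=> -[h1 h2]; split=> [i|j].
  - by have := h1 i; rewrite /= in_itv /= ler_norml.
  - exact: h2.
  - by have := h1 i; rewrite /= in_itv /= ler_norml.
  - by move=> _; exact: h2.
have cK : compact K.
  apply: compact_closedI.
    have rVc := @rV_compact R k (fun=> `[-1, 1]%classic).
    by apply: rVc => i; exact: segment_compact.
  apply: closed_bigI => j _.
  rewrite (_ : [set v | _] = H j @^-1` [set x | x <= 0]) //.
  by apply: closed_comp; [move=> x _; have [] := cH j; exact|exact: closed_le].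
have [K0|K0] := boolp.pselect (K !=set0); last first.
  (* Without feasible points any positive bound is valid. *)
  exists 1 => // v h1 h2; exfalso; apply: K0; exists v; exact/KP.
have [x Kx xmin] := compact_EVT_min K0 cK (continuous_subspaceT cF).
exists (F x).
  by have /KP[h1 h2] := set_mem Kx; exact: Fpos.
by move=> v h1 h2; apply: xmin; apply/mem_set/KP.
Qed.
End Compactness.

From mathcomp Require Import mpoly.

(** * The odd cone contains a positive integer *)

(** Bernoulli: [(b + 1)^K >= b^K + K b^(K-1)], and [K = c b + 1] makes the second term at least
    [c b^K]. *)
Lemma leq_exp_succ (b c : nat) : exists K, ((1 + c) * b ^ K <= b.+1 ^ K)%N.
Proof.
exists (c * b).+1.
have bern k : (b ^ k.+1 + k.+1 * b ^ k <= b.+1 ^ k.+1)%N.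
  elim: k => [|k IHk]; first by rewrite !expn0 !expn1; lia.
  rewrite (expnS b.+1) (expnS b k.+1).
  have : (b.+1 * (b ^ k.+1 + k.+1 * b ^ k) <= b.+1 * b.+1 ^ k.+1)%N.
    by rewrite leq_mul2l IHk.
  by apply: leq_trans; rewrite (expnS b k); nia.
apply: leq_trans (bern _); rewrite expnS; nia.
Qed.

Section GradedCone.
Variables (B : comNzRingType) (P T : B -> Prop).
Hypothesis PD : forall a b, P a -> P b -> P (a + b).
Hypothesis PM : forall a b, P a -> P b -> P (a * b).
Hypothesis TD : forall a b, T a -> T b -> T (a + b).
Hypothesis PT : forall a b, P a -> T b -> T (a * b).
Variable u : B.
Hypothesis Psq : forall i j c : nat, P ((u ^+ i - c%:R * u ^+ j) ^+ 2).

Let P0 : P 0.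
Proof. by have := Psq 0 0 1; rewrite !expr0 mulr1 subrr expr0n. Qed.

Let P1 : P 1.
Proof. by have := Psq 0 0 0; rewrite expr0 mul0r subr0 expr1n. Qed.

Let Pnat n : P n%:R.
Proof. by elim: n => [|n IHn]; rewrite ?mulr0n ?mulrS //; apply: PD. Qed.

Let PX a n : P a -> P (a ^+ n).
Proof. by move=> Pa; elim: n => [|n IHn]; rewrite ?expr0 ?exprS //; apply: PM. Qed.

Let Peven n : P (u ^+ n.*2).
Proof. by have := Psq n 0 0; rewrite mul0r subr0 -exprM muln2. Qed.

Let Psum K (F : 'I_K -> B) : (forall l, P (F l)) -> P (\sum_l F l).
Proof. by move=> PF; apply: (big_ind P). Qed.

Let PsubX x y K : P x -> P y -> P (x - y) -> P (x ^+ K - y ^+ K).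
Proof.
move=> Px Py Pxy; rewrite subrXX; apply: PM => //.
by apply: Psum => l; apply: PM; apply: PX.
Qed.

(** Reading membership in [P] as nonnegativity, this bounds [V = u^(2i+2)] by [M = N^(2i+2)]. The
    extra factor [M] stays because [B] has no division. *)
Lemma even_power_bounded (N i : nat) :
  P (N%:R * u ^+ i.*2.+1 - u ^+ i.*2.+2) ->
  P ((N%:R ^+ i.+1.*2) ^+ 2 - N%:R ^+ i.+1.*2 * u ^+ i.+1.*2).
Proof.
move=> h.
(* Twice the hypothesis plus [(u^(i+1) - N u^i)^2]: the odd powers of [u] cancel. *)
have step : P (N%:R ^+ 2 * u ^+ i.*2 - u ^+ i.*2.+2).
  have := PD (PD h h) (Psq i.+1 i N).
  by congr (P _); rewrite !exprS -addnn exprD; ring.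
have chain k : P (N%:R ^+ k.*2 * u ^+ i.+1.*2 - u ^+ (i.+1.*2 + k.*2)).
  elim: k => [|k IHk]; first by rewrite expr0 mul1r addn0 subrr.
  have := PD (PM (Pnat (N ^ 2)) IHk) (PM (Peven k.+1) step).
  by congr (P _); rewrite natrX addnC !doubleS !exprD !exprS; ring.
(* At [k = i + 1] the chain reads [M V - V^2], and adding [(V - M)^2] leaves [M^2 - M V]. *)
have := chain i.+1; set V := u ^+ i.+1.*2; set M := N%:R ^+ i.+1.*2 => hV.
have PVM : P ((V - M) ^+ 2).
  have := Psq i.+1.*2 0 (N ^ i.+1.*2)%N; by rewrite natrX expr0 mulr1.
have := PD PVM hV; congr (P _); rewrite exprD -/V; ring.
Qed.

(** Modulo [P], the element [E = a - D V] lies between 0 and [a - 1], so [E^K] is small against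
    [a^K]. Since [a^K - E^K = D V q], one has [N a^K = (N D u^(2i+1) q - N c E^K) u + N E^K (1 + c
    u)], and both summands lie in [T] once the bracket lies in [P]. *)
Lemma odd_cone_nat (N c C i : nat) :
  (0 < N)%N -> T u ->
  P (N%:R * u ^+ i.*2.+1 - u ^+ i.*2.+2) ->
  T (1 + c%:R * u) -> P (C%:R * u ^+ 2 - 1) ->
  exists2 M : nat, (0 < M)%N & T M%:R.
Proof.
move=> N0 Tu h1 h2 h3.
set V := u ^+ i.+1.*2.
pose M := (N ^ i.+1.*2)%N.
have M0 : (0 < M)%N by rewrite expn_gt0 N0.
have hM : P (M%:R ^+ 2 - M%:R * V).
  by have := even_power_bounded h1; rewrite -natrX.
have hC : P (C%:R ^+ i.+1 * V - 1).
  rewrite /V -muln2 mulnC exprM -exprMn.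
  rewrite -[X in _ - X](expr1n _ i.+1); apply: PsubX => //.
  by have := PD h3 P1; rewrite subrK.
(* The factor [C^(i+1)] turns the upper bound on [V] into [E] in [P]; the factor [M] in [D] matches
   the one carried by that bound. *)
pose D := (C ^ i.+1 * M)%N; pose a := (C ^ i.+1 * M ^ 2)%N.
have hD : P (D%:R * V - 1).
  have := PD (PM (Pnat M) hC) (Pnat M.-1).
  have -> : M.-1%:R = M%:R - 1 :> B by rewrite -{2}(prednK M0) -natr1 addrK.
  by congr (P _); rewrite /D natrM natrX; ring.
pose E := a%:R - D%:R * V.
have PE : P E.
  have := PM (Pnat (C ^ i.+1)) hM.
  by congr (P _); rewrite /E /a /D !natrM !natrX; ring.
have [a0|/prednK a1] := posnP a.
  (* then [-1 = E + (D V - 1)] lies in [P], and [1 = (1 + c u) + (-1) (c u)] *)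
  exists 1%N => //.
  have Pm1 : P (-1).
    by have := PD PE hD; congr (P _); rewrite /E a0; ring.
  have := TD h2 (PT Pm1 (PT (Pnat c) Tu)).
  by congr (T _); ring.
set b := a.-1 in a1.
have Pb : P (b%:R - E).
  by have := hD; congr (P _); rewrite /E -a1 -addn1 natrD; ring.
clearbody a D.
(* This [K] gives [(1 + N c) b^K <= a^K], where [b = a - 1] bounds [E]. *)
have [K leK] := leq_exp_succ b (N * c).
rewrite a1 in leK.
pose q := \sum_(l < K) a%:R ^+ (K.-1 - l) * E ^+ l.
have Pq : P q by apply: Psum => l; apply: PM; apply: PX.
have eq : a%:R ^+ K - E ^+ K = D%:R * V * q.
  by rewrite subrXX -/q /E; congr (_ * _); ring.
(* Multiplying [h1] by [D q] trades [D V q] for [N D u^(2i+1) q]; the other terms give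
   [a^K - (1 + N c) E^K], where [a^K] is [E^K + D V q]. *)
have hX : P (N%:R * D%:R * u ^+ i.*2.+1 * q - N%:R * c%:R * E ^+ K).
  have hb : P (b%:R ^+ K - E ^+ K) by apply: PsubX.
  have := PD (PM (PM (Pnat D) Pq) h1)
    (PD (Pnat (a ^ K - (1 + N * c) * b ^ K)) (PM (Pnat (1 + N * c)) hb)).
  congr (P _); rewrite natrB // !(natrM, natrD, natrX).
  have -> : a%:R ^+ K = E ^+ K + D%:R * V * q by rewrite -eq; ring.
  by rewrite /V doubleS; ring.
exists (N * a ^ K)%N; first by rewrite muln_gt0 N0 expn_gt0 -a1.
have := TD (PT hX Tu) (PT (PM (Pnat N) (PX K PE)) h2).
congr (T _); rewrite natrM natrX.
have -> : a%:R ^+ K = E ^+ K + D%:R * V * q by rewrite -eq; ring.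
by rewrite /V doubleS (exprS u i.*2.+1); ring.
Qed.

End GradedCone.

(** * Sums of squares of forms *)

Section Monomials.
Variables (n : nat).

Lemma mdegS_split (m : 'X_{1..n}) d :
  mdeg m = d.+1 -> exists i m', m = (U_(i) + m')%MM /\ mdeg m' = d.
Proof.
move=> dm; have : m != 0%MM by rewrite -mdeg_eq0 dm.
move=> m0; have [i mi] : exists i, m i != 0%N.
  apply/existsP; apply: contraNT m0; rewrite negb_exists => /forallP h.
  by apply/eqP/mnmP => i; rewrite mnm0E; apply/eqP; have := h i; rewrite negbK.
exists i, (m - U_(i))%MM.
have em : m = (U_(i) + (m - U_(i)))%MM by rewrite addmC submK // lep1mP.
by split=> //; move: dm; rewrite {1}em mdegD mdeg1 => -[].
Qed.

Lemma mdegD_split (m : 'X_{1..n}) d1 d2 : mdeg m = (d1 + d2)%N ->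
  exists m1 m2, [/\ m = (m1 + m2)%MM, mdeg m1 = d1 & mdeg m2 = d2].
Proof.
elim: d1 m => [|d1 IHd] m dm; first by exists 0%MM, m; rewrite add0m mdeg0.
have [i [m' [-> /IHd[m1 [m2 [-> dm1 dm2]]]]]] := mdegS_split dm.
by exists (U_(i) + m1)%MM, m2; rewrite addmA mdegD mdeg1 dm1.
Qed.

Lemma dhomog_ind (R : nzRingType) d (Q : {mpoly R[n]} -> Prop) :
  Q 0 -> (forall p q, Q p -> Q q -> Q (p + q)) ->
  (forall a m, mdeg m = d -> Q (a *: 'X_[m])) ->
  forall p, p \is d.-homog -> Q p.
Proof.
move=> Q0 QD QX p hp; rewrite [p]mpolyE big_seq.
by apply: (big_ind Q) => // m mp; apply: QX; exact: (dhomog_mf hp).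
Qed.

Lemma meval_homogZ (R : comNzRingType) d (p : {mpoly R[n]}) c v :
  p \is d.-homog -> p.@[fun i => c * v i] = c ^+ d * p.@[v].
Proof.
move: p; apply: dhomog_ind => [|p q hp hq|a m <-].
- by rewrite !meval0 mulr0.
- by rewrite !mevalD hp hq mulrDr.
- rewrite !mevalZ !mevalX mulrCA mdegE -prodrXr -big_split.
  by congr (_ * _); apply: eq_bigr => i _; rewrite exprMn.
Qed.

End Monomials.

Section SumsOfSquares.
Variables (R : realType) (n : nat).
Implicit Types (p q : {mpoly R[n.+1]}).
Notation Sos := (@sos_of_forms R n).

Lemma is_formM p q : is_form p -> is_form q -> is_form (p * q).
Proof. by move=> [d hp] [e hq]; exists (d + e)%N; exact: dhomogM. Qed.

Lemma sos0 : Sos 0.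
Proof. by exists [::]; rewrite ?big_nil. Qed.

Lemma sos_sqr p : is_form p -> Sos (p ^+ 2).
Proof.
move=> fp; exists [:: p]; last by rewrite big_seq1.
by move=> g; rewrite inE => /eqP ->.
Qed.

Lemma sosD p q : Sos p -> Sos q -> Sos (p + q).
Proof.
move=> [s hs ->] [t ht ->]; exists (s ++ t); last by rewrite big_cat.
by move=> g; rewrite mem_cat => /orP[/hs|/ht].
Qed.

Lemma sos_sum (I : Type) (r : seq I) (Q : pred I) (F : I -> {mpoly R[n.+1]}) :
  (forall i, Q i -> Sos (F i)) -> Sos (\sum_(i <- r | Q i) F i).
Proof. by move=> hF; apply: (big_ind Sos) => //; [exact: sos0|exact: sosD]. Qed.

Lemma sosM p q : Sos p -> Sos q -> Sos (p * q).
Proof.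
move=> [s hs ->] [t ht ->]; rewrite big_distrlr /= big_seq.
apply: sos_sum => g /hs fg; rewrite big_seq; apply: sos_sum => h /ht fh.
by rewrite -exprMn; apply: sos_sqr; exact: is_formM.
Qed.

Lemma sosZ a p : 0 <= a -> Sos p -> Sos (a *: p).
Proof.
move=> a0; rewrite -mul_mpolyC; apply: sosM; rewrite -(sqr_sqrtr a0).
rewrite rmorphXn; apply: sos_sqr; exists 0%N.
by rewrite /= -alg_mpolyC; apply: dhomogZ; exact: dhomog1.
Qed.

Lemma sos1 : Sos 1.
Proof. by rewrite -[1](expr1n _ 2); apply: sos_sqr; exists 0%N; exact: dhomog1. Qed.

Lemma sosX p k : Sos p -> Sos (p ^+ k).
Proof.
move=> hp; elim: k => [|k IHk]; first by rewrite expr0; exact: sos1.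
by rewrite exprS; exact: sosM.
Qed.

Lemma sos_nat k : Sos k%:R.
Proof.
elim: k => [|k IHk]; first exact: sos0.
by rewrite mulrS; apply: sosD => //; exact: sos1.
Qed.

Definition sqnorm : {mpoly R[n.+1]} := \sum_i 'X_i ^+ 2.

Lemma sqnorm_homog : sqnorm \is 2.-homog.
Proof.
apply: rpred_sum => i _; rewrite -[2%N]mul1n; apply: dhomogMn.
by rewrite dhomogX /= mdeg1.
Qed.

Lemma sqnormX_homog d : sqnorm ^+ d \is d.*2.-homog.
Proof. by rewrite -mul2n; apply: dhomogMn; exact: sqnorm_homog. Qed.

Lemma is_formX i : is_form ('X_i : {mpoly R[n.+1]}).
Proof. by exists 1%N; rewrite dhomogX /= mdeg1. Qed.

Lemma sos_sqnorm : Sos sqnorm.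
Proof. by apply: sos_sum => i _; apply: sos_sqr; exact: is_formX. Qed.

(** Induction on the degree, splitting off one variable and telescoping. *)
Lemma sos_sqnorm_sub_monomial d m :
  mdeg m = d -> Sos (sqnorm ^+ d - 'X_[m] ^+ 2).
Proof.
elim: d m => [|d IHd] m dm.
  have /eqP -> : m == 0%MM by rewrite -mdeg_eq0 dm.
  by rewrite expr0 mpolyX0 expr1n subrr; exact: sos0.
have [i [m' [-> dm']]] := mdegS_split dm.
have -> : sqnorm ^+ d.+1 - 'X_[U_(i) + m'] ^+ 2 =
    sqnorm ^+ d * (sqnorm - 'X_i ^+ 2) + 'X_i ^+ 2 * (sqnorm ^+ d - 'X_[m'] ^+ 2).
  by rewrite mpolyXD exprS; ring.
apply: sosD; apply: sosM.
- exact/sosX/sos_sqnorm.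
- rewrite /sqnorm (bigD1 i) //= addrAC subrr add0r.
  by apply: sos_sum => j _; apply: sos_sqr; exact: is_formX.
- by apply: sos_sqr; exact: is_formX.
- exact: IHd.
Qed.

(** A monomial of degree [2d] is a product of two monomials of degree [d]; twice that product, with
    either sign, completes to a square by adding the two squared monomials, each dominated by
    [sqnorm ^+ d]. *)
Lemma sos_add_sqnormX d p : p \is d.*2.-homog ->
  exists c : nat, Sos (p + c%:R * sqnorm ^+ d).
Proof.
have sosd k : Sos (k%:R * sqnorm ^+ d).
  by apply: sosM; [exact: sos_nat|exact/sosX/sos_sqnorm].
move: p; apply: dhomog_ind.
- by exists 0%N; rewrite add0r; exact: sosd.
- move=> p q [c hp] [c' hq]; exists (c + c')%N.
  by have := sosD hp hq; congr (Sos _); rewrite natrD; ring.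
- move=> a m; rewrite -addnn => /mdegD_split[m1 [m2 [-> dm1 dm2]]].
  have h1 := sos_sqnorm_sub_monomial dm1; have h2 := sos_sqnorm_sub_monomial dm2.
  (* Here [b] is the absolute value of the coefficient and [e] its sign; the certificate is [b / 2]
     times the square and the two differences [sqnorm ^+ d - 'X_[mi] ^+ 2]. *)
  have hpm (b e : R) : 0 <= b -> e ^+ 2 = 1 ->
      Sos ((b * e) *: 'X_[m1 + m2] + b *: sqnorm ^+ d).
    move=> b0 e2.
    have hsq : Sos (('X_[m1] + e *: 'X_[m2]) ^+ 2).
      apply: sos_sqr; exists d; apply: dhomogD; first by rewrite dhomogX /= dm1.
      by apply: dhomogZ; rewrite dhomogX /= dm2.
    have := sosZ (divr_ge0 b0 (ler0n _ 2)) (sosD hsq (sosD h1 h2)).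
    congr (Sos _); rewrite mpolyXD -!mul_mpolyC !mpolyCM.
    have eE : e%:MP ^+ 2 = 1 :> {mpoly R[n.+1]} by rewrite -rmorphXn e2.
    have bE : b%:MP = b%:MP * (2^-1)%:MP + b%:MP * (2^-1)%:MP :> {mpoly R[n.+1]}.
      by rewrite -!mpolyCM -mpolyCD; congr _%:MP; lra.
    rewrite {3}bE; set b' := _%:MP; set h := (2^-1)%:MP.
    set e' := e%:MP in eE *; set x1 := 'X_[m1]; set x2 := 'X_[m2].
    have -> : b' * e' = (b' * h + b' * h) * e' by rewrite -bE.
    transitivity (b' * h * ((x1 ^+ 2 + 2%:R * e' * x1 * x2 + e' ^+ 2 * x2 ^+ 2) +
      (sqnorm ^+ d - x1 ^+ 2 + (sqnorm ^+ d - x2 ^+ 2)))); first by ring.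
    by rewrite eE; ring.
  have hb := hpm `|a| (if 0 <= a then 1 else -1) (normr_ge0 a).
  (* [c + 1] exceeds [|a|]; the surplus is a nonnegative multiple of [sqnorm ^+ d]. *)
  pose c := Num.truncn `|a|.
  exists c.+1.
  have ca : 0 <= c.+1%:R - `|a| by rewrite subr_ge0 ltW // truncnS_gt.
  have e2 : (if 0 <= a then 1 else -1) ^+ 2 = 1 :> R.
    by case: ifP => _; rewrite ?sqrrN expr1n.
  have := sosD (hb e2) (sosZ ca (sosX d sos_sqnorm)).
  have -> : `|a| * (if 0 <= a then 1 else -1) = a.
    by case: ger0P => _; rewrite ?mulr1 ?mulrN1 ?opprK.
  by rewrite scalerBl -addrA [X in _ + X]addrC subrK scaler_nat mulr_natl.
Qed.

End SumsOfSquares.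

(** * Polya's theorem *)

(** At most a fraction [e^2 / L] of the maps from [e] points to [L] points fail to be injective. In
    the induction, replacing a factor [L] by [L - e] costs a further [e / L], and
    [e^2 + e <= (e + 1)^2]. *)
Lemma expn_ffact_bound e L : (e <= L)%N ->
  (L ^_ e <= L ^ e)%N /\ (L * L ^ e <= L * L ^_ e + e ^ 2 * L ^ e)%N.
Proof.
elim: e => [|e IHe] eL; first by rewrite ffactn0 expn0 leq_addr.
have [h1 h2] := IHe (ltnW eL).
rewrite ffactnSr expnS; have := subnK (ltnW eL); move: (L - e)%N => d dL.
split; first by nia.
suff : (L * (L * L ^ e) <= L * (L ^_ e * d) + e.+1 ^ 2 * (L * L ^ e))%N by [].
have h3 : (L * (L * L ^ e) <= L * (L * L ^_ e + e ^ 2 * L ^ e))%N.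
  by rewrite leq_mul2l h2 orbT.
apply: (leq_trans h3).
have h4 : (L * L ^_ e * e <= L * L ^ e * e)%N by rewrite leq_mul2r leq_mul2l h1 !orbT.
rewrite -{2}dL; nia.
Qed.

(** Coefficients are indexed by words rather than monomials, so that no multinomial coefficients
    appear in Polya's theorem. Each monomial puts its whole coefficient on one spelling. *)
Lemma dhomog_words (R : nzRingType) k e (p : {mpoly R[k]}) : p \is e.-homog ->
  exists a : {ffun 'I_e -> 'I_k} -> R,
    p = \sum_t a t *: \prod_l 'X_(t l).
Proof.
move: p; apply: dhomog_ind.
- by exists (fun=> 0); rewrite big1 // => t _; rewrite scale0r.
- move=> p q [a ->] [b ->]; exists (fun t => a t + b t).
  by rewrite -big_split; apply: eq_bigr => t _; rewrite scalerDl.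
move=> c m dm.
have [t ->] : exists t : {ffun 'I_e -> 'I_k}, 'X_[m] = \prod_l 'X_(t l) :> {mpoly R[k]}.
  elim: e m dm => [|e IHe] m dm.
    have /eqP -> : m == 0%MM by rewrite -mdeg_eq0 dm.
    have x0 : 'I_0 -> 'I_k by case.
    by exists [ffun l => x0 l]; rewrite big_ord0 mpolyX0.
  have [i [m' [-> /IHe[t et]]]] := mdegS_split dm.
  exists [ffun l => oapp t i (unlift ord0 l)].
  rewrite big_ord_recl ffunE unlift_none mpolyXD et; congr (_ * _).
  by apply: eq_bigr => l _; rewrite ffunE liftK.
exists (fun t' => if t' == t then c else 0).
rewrite (bigD1 t) //= eqxx [X in _ + X]big1 ?addr0 // => t' /negPf ->.
by rewrite scale0r.
Qed.

Section Words.
Variables (S : comNzRingType) (k e L : nat) (x : 'I_k -> S).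
Implicit Types (w : {ffun 'I_L -> 'I_k}) (t : {ffun 'I_e -> 'I_k}).

(** The letters at the [e] positions in the image of [tau] are forced to spell [t]; each of the
    [L - e] other positions is free and contributes a factor [\sum_i x i]. *)
Lemma sum_words_extending (tau : {ffun 'I_e -> 'I_L}) t : injective tau ->
  \sum_(w : {ffun 'I_L -> 'I_k} | [ffun i : 'I_e => w (tau i)] == t) \prod_l x (w l) =
  \prod_i x (t i) * (\sum_i x i) ^+ (L - e).
Proof.
move=> tau_inj.
pose Q l : pred 'I_k := [pred j | [forall i, (tau i == l) ==> (j == t i)]].
rewrite (eq_bigl (fun w : {ffun 'I_L -> 'I_k} => w \in family Q)); last first.
  move=> w; apply/eqP/familyP => [wt l|h].
    by rewrite inE; apply/forallP => i; apply/implyP => /eqP <-; rewrite -wt ffunE.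
  apply/ffunP => i; rewrite ffunE; have := h (tau i).
  by rewrite inE => /forallP /(_ i); rewrite eqxx => /eqP.
rewrite -(bigA_distr_big_dep _ (fun _ j => x j)) /=.
rewrite (bigID (mem [set tau i | i in setT])) /=; congr (_ * _).
  rewrite big_imset /=; last by move=> i j _ _; exact: tau_inj.
  apply: eq_big => [i|i _]; first by rewrite inE.
  rewrite (eq_bigl (pred1 (t i))) ?big_pred1_eq // => j.
  apply/forallP/eqP => [/(_ i)|-> i']; first by rewrite eqxx => /eqP.
  by apply/implyP => /eqP /tau_inj ->.
rewrite (eq_bigr (fun _ => \sum_i x i)).
  rewrite prodr_const; congr (_ ^+ _).
  transitivity #|~: [set tau i | i in setT]|.
    by apply: eq_card => l; rewrite !inE.
  by rewrite cardsCs setCK card_imset // cardsT !card_ord.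
move=> l lN; apply: eq_bigl => j; apply/forallP => i; apply/implyP => /eqP il.
by case/negP: lN; rewrite -il imset_f.
Qed.

End Words.

(** Expand the product once for each injective placement [tau] of [e] letters among [L] positions
    and add up, so [c] counts the injections. The coefficient of a word [w] is then a sum over
    injective [tau]; over all [tau] it would be [L^e] times the value of [F] at the letter
    frequencies of [w], and for large [L] the non-injective [tau] matter less than [lam]. *)
Lemma polya (R : realType) k e (F : {mpoly R[k]}) (lam : R) :
  F \is e.-homog -> 0 < lam ->
  (forall v : 'I_k -> R, (forall i, 0 <= v i) -> \sum_i v i = 1 -> lam <= F.@[v]) ->
  exists L c (b : {ffun 'I_L -> 'I_k} -> R),
  [/\ 0 < c, forall w, 0 <= b w &
   c *: (F * (\sum_i 'X_i) ^+ (L - e)) = \sum_w b w *: \prod_l 'X_(w l)].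
Proof.
move=> hF lam0 Fpos; have [a Fa] := dhomog_words hF.
pose A := \sum_t `|a t|.
have A0 : 0 <= A by apply: sumr_ge0 => t _.
(* Large enough for [A e^2 <= L lam], where [A e^2 / L] bounds the relative non-injective error;
   adding [e] ensures [e <= L]. *)
pose L := (Num.truncn (A * (e ^ 2)%:R / lam) + e).+1.
have eL : (e <= L)%N by rewrite leqW // leq_addl.
have LA : A * (e ^ 2)%:R <= L%:R * lam.
  rewrite -ler_pdivrMr //; apply: (le_trans (ltW (truncnS_gt _))).
  by rewrite ler_nat ltnS leq_addr.
have L0 : (0 < L%:R :> R) by rewrite ltr0n.
have [fe he] := expn_ffact_bound eL.
pose b (w : {ffun 'I_L -> 'I_k}) :=
  \sum_(tau : {ffun 'I_e -> 'I_L} | injectiveb tau) a [ffun i : 'I_e => w (tau i)].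
exists L, (L ^_ e)%:R, b; split.
- by rewrite ltr0n ffact_gt0.
- move=> w.
  have hall : L%:R ^+ e * lam <=
      \sum_(tau : {ffun 'I_e -> 'I_L}) a [ffun i : 'I_e => w (tau i)].
    (* The frequencies of the letters in [w], a point of the simplex. *)
    pose v j : R := \sum_(l | w l == j) L%:R^-1.
    have v0 j : 0 <= v j by apply: sumr_ge0 => l _; rewrite invr_ge0 ler0n.
    have v1 : \sum_j v j = 1.
      transitivity (\sum_(l < L) (L%:R^-1 : R)).
        by rewrite [RHS](partition_big (fun l => w l) predT).
      by rewrite sumr_const card_ord -[LHS]mulr_natr mulVf // gt_eqF.
    have := Fpos v v0 v1.
    rewrite Fa raddf_sum /=.
    under eq_bigr => t _ do rewrite mevalZ rmorph_prod /=.
    have -> : \sum_t a t * \prod_l ('X_(t l)).@[v] =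
        L%:R ^- e * \sum_(tau : {ffun 'I_e -> 'I_L}) a [ffun i : 'I_e => w (tau i)].
      rewrite (partition_big (fun tau : {ffun 'I_e -> 'I_L} =>
         [ffun i : 'I_e => w (tau i)]) predT) //= mulr_sumr; apply: eq_bigr => t _.
      under eq_bigr => l _ do rewrite mevalXU /v.
      rewrite (bigA_distr_big_dep (fun i l => w l == t i) (fun _ _ => L%:R^-1)) /=.
      rewrite !mulr_sumr; apply: eq_big => [tau|tau /familyP htau].
        apply/familyP/eqP => [h|<- i]; last by rewrite ffunE unfold_in.
        by apply/ffunP => i; rewrite ffunE; apply/eqP; exact: h.
      rewrite prodr_const card_ord exprVn mulrC; congr (_ * a _).
      by apply/ffunP => i; rewrite ffunE; apply/esym/eqP; exact: htau.
    by rewrite ler_pdivlMl // exprn_gt0.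
  have hnon : \sum_(tau : {ffun 'I_e -> 'I_L} | ~~ injectiveb tau)
      a [ffun i : 'I_e => w (tau i)] <= A * (L ^ e - L ^_ e)%:R.
    have <- : #|[pred tau : {ffun 'I_e -> 'I_L} | ~~ injectiveb tau]| =
        (L ^ e - L ^_ e)%N.
      have := cardC [pred tau : {ffun 'I_e -> 'I_L} | injectiveb tau].
      rewrite card_ffun !card_ord => <-.
      have := card_inj_ffuns 'I_e 'I_L; rewrite !card_ord => <-.
      by rewrite cardsE addKn.
    rewrite mulr_natr -sumr_const; apply: ler_sum => tau _.
    apply: (le_trans (ler_norm _)).
    rewrite /A (bigD1 [ffun i : 'I_e => w (tau i)]) //= lerDl.
    by apply: sumr_ge0.
  move: hall; rewrite (bigID (fun tau : {ffun 'I_e -> 'I_L} => injectiveb tau)) /=.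
  rewrite -/(b w) => hall.
  suff : A * (L ^ e - L ^_ e)%:R <= L%:R ^+ e * lam by lra.
  rewrite -(ler_pM2l L0).
  have : (L * (L ^ e - L ^_ e) <= e ^ 2 * L ^ e)%N by rewrite mulnBr; lia.
  rewrite -(ler_nat R) !natrM !natrX => hh.
  have := ler_wpM2l A0 hh.
  have := ler_wpM2r (exprn_ge0 e (ltW L0)) LA.
  rewrite natrX; lra.
rewrite scaler_nat.
transitivity (\sum_(tau : {ffun 'I_e -> 'I_L} | injectiveb tau)
   F * (\sum_i 'X_i) ^+ (L - e)).
  have := card_inj_ffuns 'I_e 'I_L; rewrite !card_ord => <-.
  by rewrite sumr_const cardsE.
under [RHS]eq_bigr => w _ do rewrite /b scaler_suml.
rewrite exchange_big /=; apply: eq_bigr => tau /injectiveP tau_inj.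
transitivity (\sum_t \sum_(w : {ffun 'I_L -> 'I_k} | [ffun i : 'I_e => w (tau i)] == t)
    a t *: \prod_l 'X_(w l) : {mpoly R[k]}).
  rewrite {1}Fa mulr_suml; apply: eq_bigr => t _.
  rewrite -scalerAl -scaler_sumr; congr (_ *: _); apply/esym.
  exact: (sum_words_extending (fun i => 'X_i)).
rewrite (exchange_big_dep predT) //=; apply: eq_bigr => w _.
by rewrite (big_pred1 [ffun i => w (tau i)]) // => t; rewrite eq_sym.
Qed.

(** * Lower bounds for forms on the sphere and the simplex *)

Lemma cts_meval (R : realType) k (p : {mpoly R[k]}) : cts (fun v => p.@[v 0]).
Proof.
have ctsext (F G : 'rV[R]_k -> R) : F =1 G -> cts F -> cts G.
  by move=> /boolp.funext ->.
have cX d i : cts (fun v : 'rV[R]_k => v 0 i ^+ d).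
  elim: d => [|d IHd]; first by apply: ctsext (cts_cst k 1) => v.
  by apply: ctsext (ctsM (cts_coord R i) IHd) => v; rewrite exprS.
have cprod (m : 'X_{1..k}) s : cts (fun v : 'rV[R]_k => \prod_(i <- s) v 0 i ^+ m i).
  elim: s => [|i s IHs]; first by apply: ctsext (cts_cst k 1) => v; rewrite big_nil.
  by apply: ctsext (ctsM (cX (m i) i) IHs) => v; rewrite big_cons.
elim/mpolyind: p => [|c m p _ _ IHp].
  by apply: ctsext (cts_cst k 0) => v; rewrite meval0.
apply: ctsext (ctsD (ctsM (cts_cst k c) (cprod m _)) IHp) => v.
by rewrite mevalD mevalZ mevalX.
Qed.

Lemma meval_lower_bound (R : realType) k (J : Type) (F : {mpoly R[k]})
    (H : J -> {mpoly R[k]}) :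
  (forall v, (forall i, `|v i| <= 1) -> (forall j, (H j).@[v] <= 0) ->
     0 < F.@[v]) ->
  exists2 e, 0 < e & forall v,
    (forall i, `|v i| <= 1) -> (forall j, (H j).@[v] <= 0) -> e <= F.@[v].
Proof.
move=> Fpos.
have [v h1 h2|e e0 he] := cts_lower_bound (cts_meval F) (fun j => cts_meval (H j)).
  exact: Fpos.
exists e => // v h1 h2.
have vE : (\row_i v i) 0 =1 v by move=> i; rewrite mxE.
rewrite -(meval_eq _ vE); apply: he => [i|j]; first by rewrite mxE.
by rewrite (meval_eq _ vE).
Qed.

(** Take the minimum of [f] on the unit sphere and extend it by homogeneity. *)
Lemma posdef_lower_bound (R : realType) n d (f : {mpoly R[n.+1]}) :
  f \is d.*2.-homog -> strictly_posdef f ->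
  exists2 e, 0 < e & forall v, e * (sqnorm R n).@[v] ^+ d <= f.@[v].
Proof.
move=> hf fpos.
have sE v : (sqnorm R n).@[v] = \sum_i v i ^+ 2.
  by rewrite raddf_sum; apply: eq_bigr => i _; rewrite /= rmorphXn /= mevalXU.
have fpos' v : (sqnorm R n).@[v] != 0 -> 0 < f.@[v].
  move=> s0; have vE : (\row_i v i) 0 =1 v by move=> i; rewrite mxE.
  rewrite -(meval_eq _ vE); apply: fpos; apply: contra s0 => /eqP/rowP v0.
  rewrite sE big1 // => i _.
  by have := v0 i; rewrite !mxE => ->; rewrite expr0n.
(* The sphere equation is encoded as two inequalities. *)
pose H (b : bool) : {mpoly R[n.+1]} := if b then sqnorm R n - 1 else 1 - sqnorm R n.
have HP v : (forall b, (H b).@[v] <= 0) <-> (sqnorm R n).@[v] = 1.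
  split=> [h|h b]; last by case: b; rewrite mevalB meval1 h subrr.
  have := h true; have := h false; rewrite !mevalB meval1 => h1 h2.
  by apply/le_anti; rewrite -subr_le0 h2 -subr_le0 h1.
have [v _ /HP s1|e e0 he] := meval_lower_bound (F := f) (H := H).
  by apply: fpos'; rewrite s1 oner_eq0.
exists e => // v.
have s0 : 0 <= (sqnorm R n).@[v].
  by rewrite sE; apply: sumr_ge0 => i _; exact: sqr_ge0.
have [sv|sv] := eqVneq (sqnorm R n).@[v] 0.
  have v0 i : v i = 0.
    move/eqP: sv; rewrite sE psumr_eq0 => [/allP h|j _]; last exact: sqr_ge0.
    by have := h i (mem_index_enum i); rewrite sqrf_eq0 => /eqP.
  case: d hf => [|d] hf; last first.
    rewrite sv expr0n mulr0; have -> : f.@[v] = f.@[fun i => 0 * v i].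
      by apply: meval_eq => i; rewrite v0 mul0r.
    by rewrite (meval_homogZ _ _ hf) doubleS expr0n mul0r.
  (* at the origin [sqnorm ^+ 0 = 1], so compare with a unit vector *)
  pose w (i : 'I_n.+1) : R := (i == ord0)%:R.
  have w1 : (sqnorm R n).@[w] = 1.
    rewrite sE (bigD1 ord0) //= /w eqxx expr1n big1 ?addr0 // => i /negPf ->.
    by rewrite expr0n.
  have -> : f.@[v] = f.@[w].
    have := meval_homogZ 0 w hf; rewrite expr0 mul1r => <-.
    by apply: meval_eq => i; rewrite v0 mul0r.
  rewrite expr0 mulr1; apply: he; last exact/HP.
  by move=> i; rewrite /w; case: eqP; rewrite ?normr1 ?normr0.
have sp : 0 < (sqnorm R n).@[v] by rewrite lt_neqAle eq_sym sv.
pose r := Num.sqrt (sqnorm R n).@[v].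
have r0 : 0 < r by rewrite sqrtr_gt0.
have rs : r ^+ 2 = (sqnorm R n).@[v] by rewrite sqr_sqrtr.
pose w i := r^-1 * v i.
have w1 : (sqnorm R n).@[w] = 1.
  rewrite (meval_homogZ _ _ (sqnorm_homog R n)) exprVn rs mulVf //.
have := he w; rewrite (meval_homogZ _ _ hf) => hw.
rewrite -rs -exprM mul2n -ler_pdivlMr ?exprn_gt0 // mulrC -exprVn.
apply: hw; last exact/HP.
move=> i; rewrite -(ler_pXn2r (n := 2)) ?nnegrE // expr1n -w1 sE real_normK ?num_real //.
by rewrite (bigD1 i) //= lerDl; apply: sumr_ge0 => j _; exact: sqr_ge0.
Qed.

Definition in_simplex (R : realType) k (v : 'I_k -> R) : Prop :=
  (forall i, 0 <= v i) /\ \sum_i v i = 1.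

Lemma in_simplex_le1 (R : realType) k (v : 'I_k -> R) i : in_simplex v -> v i <= 1.
Proof.
by move=> [v0 <-]; rewrite (bigD1 i) //= lerDl; apply: sumr_ge0.
Qed.

Lemma simplex_lower_bound (R : realType) k (F G : {mpoly R[k]}) :
  (forall v, in_simplex v -> G.@[v] <= 0 -> 0 < F.@[v]) ->
  exists2 e, 0 < e & forall v, in_simplex v -> G.@[v] <= 0 -> e <= F.@[v].
Proof.
move=> Fpos; pose Y : {mpoly R[k]} := \sum_i 'X_i.
have YE v : Y.@[v] = \sum_i v i.
  by rewrite raddf_sum; apply: eq_bigr => i _; rewrite /= mevalXU.
pose H (j : option ('I_k + bool)) := match j with
  | None => G | Some (inl i) => - 'X_i
  | Some (inr b) => if b then Y - 1 else 1 - Y end.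
have HP v : (forall j, (H j).@[v] <= 0) <-> in_simplex v /\ G.@[v] <= 0.
  split=> [h|[[v0 v1] Gv] [[i|b]|]] //=.
  - split; last exact: (h None).
    split=> [i|]; first by have := h (Some (inl i)); rewrite /= mevalN mevalXU oppr_le0.
    have := h (Some (inr true)); have := h (Some (inr false)).
    rewrite /= !mevalB meval1 YE => h1 h2.
    by apply/le_anti; rewrite -subr_le0 h2 -subr_le0 h1.
  - by rewrite mevalN mevalXU oppr_le0.
  - by case: b; rewrite mevalB meval1 YE v1 subrr.
have [v _ /HP[]|e e0 he] := meval_lower_bound (F := F) (H := H).
  exact: Fpos.
exists e => // v sv Gv; apply: he; last exact/HP.
by move=> i; rewrite ger0_norm ?(in_simplex_le1 _ sv) //; case: sv.
Qed.

(** On the simplex every monomial takes values in [[0, 1]], so the sum of the absolute values of the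
    coefficients serves as [B]. *)
Lemma simplex_bounded (R : realType) k (F : {mpoly R[k]}) :
  exists B, forall v, in_simplex v -> - B <= F.@[v].
Proof.
exists (\sum_(m <- msupp F) `|F@_m|) => v sv.
rewrite mevalE -sumrN; apply: ler_sum => m _.
set x := \prod_i _.
have /andP[x0 x1] : 0 <= x <= 1.
  rewrite /x; apply: (big_ind (fun y : R => 0 <= y <= 1)) => [|y z|i _].
  - by rewrite ler01 lexx.
  - by move=> /andP[y0 y1] /andP[z0 z1]; rewrite mulr_ge0 //= mulr_ile1.
  - have [v0 _] := sv.
    by rewrite exprn_ge0 ?exprn_ile1 // (in_simplex_le1 _ sv).
have := ler_norm (- F@_m); rewrite normrN => h.
have h2 := normr_ge0 F@_m.
nra.
Qed.

(** On the compact part where [G <= 0] the penalty [P] has a positive minimum [e], so a large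
    multiple of it outweighs the lower bound [- B] of [G]; elsewhere [G] is already positive. *)
Lemma simplex_penalty (R : realType) k (G P : {mpoly R[k]}) :
  (forall v, in_simplex v -> 0 <= P.@[v]) ->
  (forall v, in_simplex v -> P.@[v] = 0 -> 0 < G.@[v]) ->
  exists c, forall v, in_simplex v -> 0 < G.@[v] + c * P.@[v].
Proof.
move=> P0 GP.
have [v sv Gv|e e0 he] := simplex_lower_bound (F := P) (G := G).
  rewrite lt_neqAle P0 // andbT; apply/eqP => /esym /(GP _ sv).
  by rewrite ltNge Gv.
have [B hB] := simplex_bounded G.
pose c := (`|B| + 1) / e.
have c0 : 0 <= c by apply: divr_ge0; [rewrite addr_ge0|exact: ltW].
exists c => v sv; have [Gv|Gv] := lerP G.@[v] 0.
  have h1 : `|B| + 1 <= c * P.@[v].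
    have -> : `|B| + 1 = c * e by rewrite /c divfK // gt_eqF.
    by rewrite ler_wpM2l // he.
  have := hB _ sv; have := ler_norm B; lra.
by rewrite ltr_wpDr // mulr_ge0 // P0.
Qed.

(** * Multiplying a positive form by a power of the square norm *)

(** [Z i j] plays the role of [4 x_i x_j]. The linear relations are polarization, and the quadratic
    ones say that [Z] has rank at most one. The relation for [m i i] forces it to vanish, so
    [Z i i = p i i >= 0]; a nonzero diagonal entry [Z i i] then gives
    [x_j = Z i j / (2 sqrt (Z i i))]. *)
Lemma rank_one_squares (R : rcfType) (I : finType) (p m : I -> I -> R)
    (Z := fun i j => p i j - m i j) :
  (forall i j, 0 <= p i j) ->
  (forall i j, 4%:R * p i j = Z i i + Z j j + 2%:R * Z i j) ->
  (forall i j, 4%:R * m i j = Z i i + Z j j - 2%:R * Z i j) ->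
  (forall i j l, Z i i * Z j l = Z i j * Z i l) ->
  (exists i j, p i j != 0 \/ m i j != 0) ->
  exists x : I -> R, (exists i, x i != 0) /\
    forall i j, p i j = (x i + x j) ^+ 2 /\ m i j = (x i - x j) ^+ 2.
Proof.
move=> p0 pE mE ZE nz.
have Zii i : 0 <= Z i i.
  by have := mE i i; have := p0 i i; rewrite /Z; lra.
have [/existsP[i Zi]|/existsPn Z0] := boolP [exists i, Z i i != 0]; last first.
  have {}Z0 i : Z i i = 0 by apply/eqP; have := Z0 i; rewrite negbK.
  have Z0' i j : Z i j = 0.
    by have := ZE i j j; rewrite !Z0 mul0r => /esym/eqP; rewrite mulf_eq0 orbb => /eqP.
  have [i [j]] := nz; have := pE i j; have := mE i j.
  by rewrite !Z0' => h1 h2 [] /eqP[]; lra.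
have zi : 0 < Z i i by rewrite lt_neqAle eq_sym Zi Zii.
pose s := Num.sqrt (Z i i).
have s0 : 0 < s by rewrite sqrtr_gt0.
have sE : s ^+ 2 = Z i i by rewrite sqr_sqrtr.
pose x j := Z i j / (2%:R * s).
have xE j l : x j * x l = Z j l / 4%:R.
  have -> : Z j l = Z i j * Z i l / s ^+ 2 by rewrite -ZE sE mulrC mulKf.
  by rewrite /x; field; exact: lt0r_neq0.
exists x; split.
  exists i; apply/eqP => xi; have := xE i i; rewrite xi mul0r; lra.
move=> j l; have := xE j j; have := xE l l; have := xE j l.
have := pE j l; have := mE j l; split; rewrite ?sqrrD ?sqrrB ?expr2; lra.
Qed.

(** * Lifting even forms along the quadratic substitution *)

Section SquareVariables.
Variables (R : realType) (n : nat).
Notation idx := ('I_n.+1 * 'I_n.+1 * bool)%type.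
Notation k := #|{: idx}|.

(* The variable of index [(i, j, b)] stands for [(x_i + x_j)^2] or [(x_i - x_j)^2]. *)
Definition square_form (t : idx) : {mpoly R[n.+1]} :=
  (if t.2 then 'X_t.1.1 + 'X_t.1.2 else 'X_t.1.1 - 'X_t.1.2) ^+ 2.

Definition square_sub : k.-tuple {mpoly R[n.+1]} :=
  [tuple square_form (enum_val t) | t < k].

Definition svar (t : idx) : {mpoly R[k]} := 'X_(enum_rank t).

Definition cross i j : {mpoly R[k]} := svar (i, j, true) - svar (i, j, false).

Definition total : {mpoly R[k]} := \sum_t 'X_t.

(** The sum of the squared equations of [rank_one_squares]. The factor [total ^+ 2] raises the
    squared linear equations to degree 4, to make the whole homogeneous, and equals 1 on the
    simplex. *)
Definition rank_one_defect : {mpoly R[k]} :=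
  (\sum_i \sum_j
    ((4%:R * svar (i, j, true) - (cross i i + cross j j + 2%:R * cross i j)) ^+ 2 +
     (4%:R * svar (i, j, false) - (cross i i + cross j j - 2%:R * cross i j)) ^+ 2))
    * total ^+ 2 +
  \sum_i \sum_j \sum_l (cross i i * cross j l - cross i j * cross i l) ^+ 2.

Lemma svar_sub t : svar t \mPo square_sub = square_form t.
Proof. by rewrite comp_mpolyXU -tnth_nth tnth_mktuple enum_rankK. Qed.

Lemma cross_sub i j : cross i j \mPo square_sub = 4%:R * 'X_i * 'X_j.
Proof. by rewrite comp_mpolyB !svar_sub /square_form /=; ring. Qed.

(** [(x_i + x_j)^2 + (x_i - x_j)^2 = 2 (x_i^2 + x_j^2)]: having both signs among the variables is
    what turns Polya's multiplier into a power of [sqnorm]. *)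
Lemma total_sub : total \mPo square_sub = (4 * n.+1)%:R * sqnorm R n.
Proof.
rewrite raddf_sum /=.
rewrite (eq_bigr (fun t => square_form (enum_val t))); last first.
  by move=> t _; rewrite comp_mpolyXU -tnth_nth tnth_mktuple.
rewrite -(big_enum_val (A := {: idx}) square_form) /=.
transitivity (\sum_(i < n.+1) \sum_(j < n.+1)
    (square_form (i, j, true) + square_form (i, j, false))).
  rewrite (pair_bigA _ (fun i j => square_form (i, j, true) + square_form (i, j, false))) /=.
  transitivity (\sum_(ij : 'I_n.+1 * 'I_n.+1) \sum_(b : bool) square_form (ij, b)).
    rewrite (pair_bigA _ (fun ij b => square_form (ij, b))) /=.
    by apply: eq_big => [t|[ij b]].
  by apply: eq_bigr => -[i j] _; rewrite big_bool.
transitivity (\sum_(i < n.+1) \sum_(j < n.+1)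
    2%:R * ('X_i ^+ 2 + 'X_j ^+ 2) : {mpoly R[n.+1]}).
  by apply: eq_bigr => i _; apply: eq_bigr => j _; rewrite /square_form /=; ring.
under eq_bigr => i _.
  rewrite -mulr_sumr big_split /= sumr_const card_ord; over.
rewrite -mulr_sumr big_split /= sumrMnl sumr_const card_ord -/(sqnorm R n).
by rewrite natrM -mulr_natl; ring.
Qed.

Lemma total_homog : total \is 1.-homog.
Proof. by apply: rpred_sum => t _; rewrite dhomogX /= mdeg1. Qed.

Lemma svar_homog t : svar t \is 1.-homog.
Proof. by rewrite dhomogX /= mdeg1. Qed.

Lemma cross_homog i j : cross i j \is 1.-homog.
Proof. by apply: rpredB; exact: svar_homog. Qed.

Lemma rank_one_defect_homog : rank_one_defect \is 4.-homog.
Proof.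
have nat_homog c (p : {mpoly R[k]}) : p \is 1.-homog -> c%:R * p \is 1.-homog.
  by move=> hp; rewrite mulr_natl; apply: rpredMn.
apply: rpredD.
  rewrite -[4%N]/(2 + 1 * 2)%N; apply: dhomogM; last exact/dhomogMn/total_homog.
  apply: rpred_sum => i _; apply: rpred_sum => j _; rewrite -[2%N]mul1n.
  by apply: rpredD; apply: dhomogMn;
    do ?[exact: cross_homog|exact: svar_homog|apply: nat_homog
        |apply: rpredB|apply: rpredD].
apply: rpred_sum => i _; apply: rpred_sum => j _; apply: rpred_sum => l _.
rewrite -[4%N]/(2 * 2)%N; apply: dhomogMn; rewrite -[2%N]/(1 + 1)%N.
by apply: rpredB; apply: dhomogM; exact: cross_homog.
Qed.

Lemma rank_one_defect_sub : rank_one_defect \mPo square_sub = 0.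
Proof.
rewrite /rank_one_defect comp_mpolyD rmorphM /= !raddf_sum /= big1 ?mul0r ?add0r => [|i _].
  rewrite big1 // => i _; rewrite raddf_sum big1 // => j _; rewrite raddf_sum big1 // => l _.
  by rewrite /= rmorphXn rmorphB !rmorphM /= !cross_sub; ring.
rewrite raddf_sum big1 // => j _; rewrite /=.
rewrite !(rmorphD, rmorphN, rmorphXn, rmorphM, rmorph_nat) /=.
by rewrite !svar_sub /square_form /=; ring.
Qed.

(** Pair up the variables of each monomial and replace [x_i x_j] by [cross i j / 4]. *)
Lemma lift_square_sub d (g : {mpoly R[n.+1]}) : g \is d.*2.-homog ->
  exists2 G : {mpoly R[k]}, G \is d.-homog & G \mPo square_sub = g.
Proof.
move: g; apply: dhomog_ind => [|p q [G hG <-] [H hH <-]|a m dm].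
- by exists 0; rewrite ?dhomog0 ?comp_mpoly0.
- by exists (G + H); rewrite ?rpredD ?comp_mpolyD.
suff [G hG Gm] : exists2 G : {mpoly R[k]}, G \is d.-homog & G \mPo square_sub = 'X_[m].
  by exists (a *: G); [exact: dhomogZ|rewrite comp_mpolyZ Gm].
elim: d m dm => [|d IHd] m; last rewrite doubleS.
  by move/eqP; rewrite mdeg_eq0 => /eqP ->; exists 1; rewrite ?dhomog1 ?comp_mpoly1 ?mpolyX0.
move=> /mdegS_split[i [m1 [-> /mdegS_split[j [m2 [-> /IHd[G hG Gm]]]]]]].
exists (4%:R^-1 *: (cross i j * G)).
  by apply: dhomogZ; exact: (dhomogM (cross_homog i j) hG).
rewrite comp_mpolyZ rmorphM /= cross_sub Gm !mpolyXD -!mulrA mulr_natl.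
by rewrite -scaler_nat scalerA mulVf ?scale1r // pnatr_eq0.
Qed.

(** A vanishing sum of squares makes every equation hold, so [rank_one_squares] applies; its
    nonvanishing condition comes from the coordinates of [v] summing to 1. *)
Lemma rank_one_point v : in_simplex v -> rank_one_defect.@[v] = 0 ->
  exists2 x : 'rV[R]_n.+1, x != 0 & v =1 fun t => (tnth square_sub t).@[x 0].
Proof.
move=> [v0 v1] Dv.
pose y i j b := v (enum_rank (i, j, b)).
have svE i j b : (svar (i, j, b)).@[v] = y i j b by rewrite mevalXU.
have crE i j : (cross i j).@[v] = y i j true - y i j false.
  by rewrite mevalB !svE.
have tE : total.@[v] = 1.
  by rewrite raddf_sum -[RHS]v1; apply: eq_bigr => t _; rewrite /= mevalXU.
pose Z i j := y i j true - y i j false.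
pose d1 i j := 4%:R * y i j true - (Z i i + Z j j + 2%:R * Z i j).
pose d2 i j := 4%:R * y i j false - (Z i i + Z j j - 2%:R * Z i j).
pose d3 i j l := Z i i * Z j l - Z i j * Z i l.
have DE : (rank_one_defect).@[v] =
    \sum_i \sum_j (d1 i j ^+ 2 + d2 i j ^+ 2) + \sum_i \sum_j \sum_l d3 i j l ^+ 2.
  rewrite /rank_one_defect mevalD mevalM rmorphXn /= tE expr1n mulr1.
  congr (_ + _); rewrite raddf_sum; apply: eq_bigr => i _;
    rewrite raddf_sum; apply: eq_bigr => j _.
    rewrite /= !(mevalD, mevalM, mevalN, rmorphXn) /=.
    by rewrite !mevalXU !meval1 /d1 /d2 /Z /y; ring.
  rewrite raddf_sum; apply: eq_bigr => l _.
  by rewrite /= !(mevalD, mevalM, mevalN, rmorphXn) /= !mevalXU.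
have ge12 i j : 0 <= d1 i j ^+ 2 + d2 i j ^+ 2 by rewrite addr_ge0 ?sqr_ge0.
move/eqP: Dv; rewrite DE paddr_eq0; last first.
- by do 3!apply: sumr_ge0 => ? _; exact: sqr_ge0.
- by do 2!apply: sumr_ge0 => ? _.
case/andP => /eqP D12 /eqP D3.
have d12 i j : d1 i j ^+ 2 + d2 i j ^+ 2 = 0.
  have h1 := psumr_eq0P (fun i _ => sumr_ge0 _ (fun j _ => ge12 i j)) D12 (i := i) isT.
  exact: (psumr_eq0P (fun j _ => ge12 i j) h1).
have d3E i j l : d3 i j l = 0.
  have h1 := psumr_eq0P (fun i _ => sumr_ge0 _ (fun j _ =>
    sumr_ge0 _ (fun l _ => sqr_ge0 (d3 i j l)))) D3 (i := i) isT.
  have h2 := psumr_eq0P (fun j _ => sumr_ge0 _ (fun l _ => sqr_ge0 (d3 i j l))) h1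
    (i := j) isT.
  have := psumr_eq0P (fun l _ => sqr_ge0 (d3 i j l)) h2 (i := l) isT.
  by move/eqP; rewrite sqrf_eq0 => /eqP.
have [||||| x [[i xi] hx]] := @rank_one_squares R 'I_n.+1
  (fun i j => y i j true) (fun i j => y i j false).
- by move=> i j; exact: v0.
- move=> i j; move/eqP: (d12 i j); rewrite paddr_eq0 ?sqr_ge0 // !sqrf_eq0.
  by case/andP=> /eqP h _; apply/eqP; rewrite -subr_eq0; apply/eqP.
- move=> i j; move/eqP: (d12 i j); rewrite paddr_eq0 ?sqr_ge0 // !sqrf_eq0.
  by case/andP=> _ /eqP h; apply/eqP; rewrite -subr_eq0; apply/eqP.
- by move=> i j l; apply/eqP; rewrite -subr_eq0; apply/eqP; exact: d3E.
- have [/existsP[t vt]|/existsPn vz] := boolP [exists t, v t != 0]; last first.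
    have /eqP := v1; rewrite big1 ?[0 == 1]eq_sym ?oner_eq0 // => t _.
    by apply/eqP; have := vz t; rewrite negbK.
  move: vt; rewrite -(enum_valK t); case: (enum_val t) => -[i j] [] h; exists i, j.
    by left.
  by right.
exists (\row_i x i).
  by apply: contra xi => /eqP/rowP/(_ i); rewrite !mxE => ->.
move=> t; rewrite tnth_mktuple -{1}(enum_valK t).
case: (enum_val t) => -[j l] b; rewrite /square_form /= rmorphXn /=.
have [h1 h2] := hx j l.
by case: b; rewrite ?mevalB ?mevalD !mevalXU !mxE; [exact: h1|exact: h2].
Qed.

(** The penalized lift is positive on the simplex, so Polya's theorem applies to it. Substituting
    back kills the defect, sends [total] to a multiple of [sqnorm], and makes every variable the
    square of a linear form. *)
Lemma posdef_sqnormX_sos d (g : {mpoly R[n.+1]}) :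
  g \is d.*2.-homog -> strictly_posdef g ->
  exists r, sos_of_forms (sqnorm R n ^+ r * g).
Proof.
move=> hg gpos; have [G hG Gg] := lift_square_sub hg.
have Gpos v : in_simplex v -> rank_one_defect.@[v] = 0 -> 0 < G.@[v].
  move=> sv /(rank_one_point sv)[x x0 vx].
  by rewrite (meval_eq _ vx) -comp_mpoly_meval Gg; exact: gpos.
have defect_ge0 v : in_simplex v -> 0 <= rank_one_defect.@[v].
  move=> _; rewrite /rank_one_defect mevalD mevalM rmorphXn /=.
  apply: addr_ge0; [apply: mulr_ge0; last exact: sqr_ge0|];
    rewrite raddf_sum; apply: sumr_ge0 => i _;
    rewrite raddf_sum; apply: sumr_ge0 => j _ /=.
    by rewrite mevalD !rmorphXn /= addr_ge0 ?sqr_ge0.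
  by rewrite raddf_sum; apply: sumr_ge0 => l _ /=; rewrite rmorphXn /= sqr_ge0.
have [c cpos] := simplex_penalty defect_ge0 Gpos.
(* Powers of [total] bring both terms to degree [d + 4] without changing values on the simplex. *)
pose F := G * total ^+ 4 + c *: (rank_one_defect * total ^+ d).
have hF : F \is (d + 4).-homog.
  apply: rpredD.
    by apply: dhomogM => //; rewrite -[4%N]mul1n; exact/dhomogMn/total_homog.
  apply: dhomogZ; rewrite addnC; apply: dhomogM; first exact: rank_one_defect_homog.
  by rewrite -[d in d.-homog]mul1n; exact/dhomogMn/total_homog.
have totE v : in_simplex v -> total.@[v] = 1.
  by move=> [_ <-]; rewrite raddf_sum; apply: eq_bigr => t _; rewrite /= mevalXU.
(* The constraint polynomial 0 leaves the whole simplex feasible. *)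
have Fpos v : in_simplex v -> (0 : {mpoly R[k]}).@[v] <= 0 -> 0 < F.@[v].
  move=> sv _; rewrite mevalD mevalZ !mevalM !rmorphXn /= totE // !expr1n !mulr1.
  exact: cpos.
have [lam lam0 hlam] := simplex_lower_bound Fpos.
have {}hlam v : (forall i, 0 <= v i) -> \sum_i v i = 1 -> lam <= F.@[v].
  by move=> v0 v1; apply: hlam; rewrite ?meval0 //; split.
have [L [a [b [a0 b0 FE]]]] := polya hF lam0 hlam.
set r := (L - _)%N in FE.
pose N : R := (4 * n.+1)%:R.
have N0 : 0 < N by rewrite ltr0n.
have := congr1 (comp_mpoly square_sub) FE.
rewrite comp_mpolyZ rmorphM rmorphXn /= -/total total_sub.
rewrite comp_mpolyD comp_mpolyZ [(G * _) \mPo _]rmorphM /=.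
rewrite [(rank_one_defect * _) \mPo _]rmorphM /=.
rewrite rank_one_defect_sub mul0r scaler0 addr0 Gg rmorphXn /= total_sub => E.
exists (4 + r)%N.
have -> : sqnorm R n ^+ (4 + r) * g =
    ((a * N ^+ (4 + r))^-1 * a) *: ((4 * n.+1)%:R ^+ (4 + r) * (sqnorm R n ^+ (4 + r) * g)).
  have -> : (4 * n.+1)%:R ^+ (4 + r) = (N ^+ (4 + r))%:MP :> {mpoly R[n.+1]}.
    by rewrite rmorphXn /= mpolyC_nat.
  rewrite mul_mpolyC scalerA -mulrA mulVf ?scale1r //.
  by rewrite gt_eqF // mulr_gt0 // exprn_gt0.
rewrite -scalerA; apply: sosZ; first by rewrite invr_ge0 mulr_ge0 ?exprn_ge0 ?ltW.
have -> : (4 * n.+1)%:R ^+ (4 + r) * (sqnorm R n ^+ (4 + r) * g) =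
   g * ((4 * n.+1)%:R * sqnorm R n) ^+ 4 * ((4 * n.+1)%:R * sqnorm R n) ^+ r.
  by rewrite mulrA -exprMn exprD; ring.
rewrite E raddf_sum /=; apply: sos_sum => w _.
rewrite comp_mpolyZ; apply: sosZ => //.
rewrite rmorph_prod /=; apply: (big_ind (@sos_of_forms R n)).
- exact: sos1.
- exact: sosM.
- move=> l _; rewrite comp_mpolyXU -tnth_nth tnth_mktuple.
  apply: sos_sqr; exists 1%N; case: ifP => _.
    by apply: rpredD; rewrite dhomogX /= mdeg1.
  by apply: rpredB; rewrite dhomogX /= mdeg1.
Qed.

End SquareVariables.

(** * Fractions with a power of the form as denominator *)

Local Notation "x %:F" := (tofrac x).

Section PowerOfForm.
Variables (R : realType) (n : nat).
Notation Sos := (@sos_of_forms R n).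

Lemma strictly_posdef_even d (f : {mpoly R[n.+1]}) :
  f \is d.-homog -> strictly_posdef f -> ~~ odd d.
Proof.
move=> hf fpos; apply/negP => oddd.
pose w : 'rV[R]_n.+1 := const_mx 1.
have w0 : w != 0 by apply/eqP => /rowP/(_ ord0)/eqP; rewrite !mxE oner_eq0.
have := fpos _ w0; have := fpos (- w); rewrite oppr_eq0 => /(_ w0).
have -> : f.@[(- w) 0] = f.@[fun i => -1 * w 0 i].
  by apply: meval_eq => i; rewrite mxE mulN1r.
rewrite (meval_homogZ _ _ hf) -signr_odd oddd expr1; lra.
Qed.

Lemma sos_strictly_posdef_const (f : {mpoly R[n.+1]}) :
  f \is 0.-homog -> strictly_posdef f -> Sos f.
Proof.
move=> hf fpos; pose w : 'rV[R]_n.+1 := const_mx 1.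
have w0 : w != 0 by apply/eqP => /rowP/(_ ord0)/eqP; rewrite !mxE oner_eq0.
have -> : f = f.@[w 0] *: 1.
  move: f hf {fpos}; apply: dhomog_ind => [|p q hp hq|a m /eqP].
  - by rewrite meval0 scale0r.
  - by rewrite mevalD scalerDl -hp -hq.
  - by rewrite mdeg_eq0 => /eqP ->; rewrite mpolyX0 mevalZ meval1 mulr1.
by apply: sosZ; [exact/ltW/fpos|exact: sos1].
Qed.

Variables (d : nat) (f : {mpoly R[n.+1]}).
Hypotheses (hf : f \is d.*2.-homog) (fpos : strictly_posdef f).
Notation s := (sqnorm R n ^+ d).

Lemma sos_evenX i : Sos (f ^+ i.*2).
Proof.
by rewrite -muln2 exprM; apply: sos_sqr; exists (d.*2 * i)%N; exact: dhomogMn.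
Qed.

(** Add up bounds for [f] and for [- f]; the second certificate is the product
    [(c s + f) (c s - f)]. *)
Lemma exists_sos_bound : exists c : nat,
  Sos (f + c%:R * s) /\ Sos ((c ^ 2)%:R * s ^+ 2 - f ^+ 2).
Proof.
have [c1 h1] := sos_add_sqnormX hf.
have [c2 h2] : exists c : nat, Sos (- f + c%:R * s).
  by apply: sos_add_sqnormX; rewrite dhomogN.
have hs k : Sos (k%:R * s) by apply: sosM; [exact: sos_nat|exact/sosX/sos_sqnorm].
have h1' := sosD h1 (hs c2); have h2' := sosD h2 (hs c1).
exists (c1 + c2)%N; split; first by move: h1'; congr (Sos _); rewrite natrD; ring.
by have := sosM h1' h2'; congr (Sos _); rewrite natrX natrD; ring.
Qed.

(** If [e s <= f] and [N > 1 / e], then [N f - s] is positive definite. The power [sqnorm ^+ r] that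
    makes it a sum of squares is completed to [s ^+ r.*2.+1], which is possible as [d > 0]; with
    this odd exponent, dividing by [f ^+ r.*2.+2] gives an expression in [u = s / f] lying in the
    even cone. *)
Lemma exists_sos_multiple : (0 < d)%N -> exists N i : nat, (0 < N)%N /\
  Sos (s ^+ i.*2.+1 * (N%:R * f - s)).
Proof.
move=> d0; have [e e0 he] := posdef_lower_bound hf fpos.
pose N := (Num.truncn e^-1).+1.
have Ne : e^-1 < N%:R by exact: truncnS_gt.
pose g := N%:R * f - s.
have hg : g \is d.*2.-homog.
  by apply: rpredB; [rewrite mulr_natl; exact: rpredMn|exact: sqnormX_homog].
have gpos : strictly_posdef g.
  move=> xi xi0; rewrite mevalB mevalM rmorph_nat rmorphXn /= subr_gt0.
  have fxi := fpos xi0; have := he (xi 0); rewrite mulrC -ler_pdivlMr // => h.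
  by apply: (le_lt_trans h); rewrite mulrC ltr_pM2r.
have [r hr] := posdef_sqnormX_sos hg gpos.
exists N, r; split=> //.
have rd : (r <= d * r.*2.+1)%N by rewrite -[X in (X <= _)%N]mul1n leq_mul //; lia.
rewrite -exprM -(subnK rd) exprD -mulrA; apply: sosM => //.
exact/sosX/sos_sqnorm.
Qed.

(* [cone false] and [cone true] consist of the fractions [p / f ^ k] with [p] a sum
   of squares of forms and [k] even, respectively odd. *)
Definition cone (b : bool) (a : {fraction {mpoly R[n.+1]}}) : Prop :=
  exists2 k : nat, odd k = b & exists2 p, Sos p & a * f%:F ^+ k = p%:F.

(** Exponents of equal parity differ by an even number, so passing to a common denominator
    multiplies a numerator by a square. *)
Lemma coneD b a a' : cone b a -> cone b a' -> cone b (a + a').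
Proof.
move=> [k kb [p hp ap]] [l lb [q hq aq]].
wlog kl : a a' k l p q kb lb hp hq ap aq / (k <= l)%N => [hw|].
  have [kl|/ltnW lk] := leqP k l; first exact: (hw _ _ k l p q).
  by rewrite addrC; exact: (hw _ _ l k q p).
exists l => //; exists (p * f ^+ (l - k) + q).
  apply: sosD => //; apply: sosM => //.
  by rewrite -(even_halfK (_ : ~~ odd (l - k))) ?oddB ?kb ?lb ?addbb //; exact: sos_evenX.
by rewrite mulrDl aq tofracD tofracM tofracXn -ap -mulrA -exprD subnKC.
Qed.

Lemma coneM b a a' : cone false a -> cone b a' -> cone b (a * a').
Proof.
move=> [k kb [p hp ap]] [l lb [q hq aq]].
exists (k + l)%N; first by rewrite oddD kb lb.
by exists (p * q); [exact: sosM|rewrite tofracM -ap -aq exprD; ring].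
Qed.

Lemma odd_power_sos : exists m : nat, [/\ odd m, (1 <= m)%N & Sos (f ^+ m)].
Proof.
have [d0|d_gt0] := posnP d.
  exists 1%N; split=> //; rewrite expr1; apply: sos_strictly_posdef_const => //.
  by move: hf; rewrite d0.
have [c [hc1 hc2]] := exists_sos_bound.
have [N [i [N0 hN]]] := exists_sos_multiple d_gt0.
have fF0 : f%:F != 0.
  rewrite tofrac_eq0; apply/eqP => f0.
  pose w : 'rV[R]_n.+1 := const_mx 1.
  have w0 : w != 0 by apply/eqP => /rowP/(_ ord0)/eqP; rewrite !mxE oner_eq0.
  by have := fpos w0; rewrite f0 meval0 ltxx.
have := sqnormX_homog R n d; have : Sos s by exact/sosX/sos_sqnorm.
(* From here on [s] is an arbitrary sum of squares, homogeneous of the degree of [f]. *)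
move: s hc1 hc2 hN => s hc1 hc2 hN ss hs.
pose u := s%:F / f%:F.
have uf : u * f%:F = s%:F by rewrite mulfVK.
have uX a : u ^+ a * f%:F ^+ a = (s ^+ a)%:F by rewrite -exprMn uf -tofracXn.
have Psq k l m : cone false ((u ^+ k - m%:R * u ^+ l) ^+ 2).
  exists (k + l).*2; first by rewrite odd_double.
  (* The numerator of [u^k - m u^l] over [f^(k+l)]; both of its terms have degree [2d (k + l)], so
     it is a form. *)
  exists ((s ^+ k * f ^+ l - m%:R * (s ^+ l * f ^+ k)) ^+ 2).
    apply: sos_sqr; exists (d.*2 * (k + l))%N.
    apply: rpredB; last rewrite mulr_natl; last apply: rpredMn.
      by rewrite mulnDr; apply: dhomogM; exact: dhomogMn.
    by rewrite addnC mulnDr; apply: dhomogM; exact: dhomogMn.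
  rewrite tofracXn tofracB !tofracM !tofracXn rmorph_nat -muln2 exprM -exprMn.
  by rewrite -uf !exprMn exprD; ring.
have Tu : cone true u by exists 1%N => //; exists s.
have h1 : cone false (N%:R * u ^+ i.*2.+1 - u ^+ i.*2.+2).
  exists i.*2.+2; first by rewrite /= odd_double.
  exists (s ^+ i.*2.+1 * (N%:R * f - s)) => //.
  rewrite tofracM tofracB tofracM rmorph_nat -uX -uf.
  by rewrite !(exprS _ i.*2.+1); ring.
have h2 : cone true (1 + c%:R * u).
  exists 1%N => //; exists (f + c%:R * s) => //.
  by rewrite tofracD tofracM rmorph_nat -uf expr1; ring.
have h3 : cone false ((c ^ 2)%:R * u ^+ 2 - 1).
  exists 2%N => //; exists ((c ^ 2)%:R * s ^+ 2 - f ^+ 2) => //.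
  by rewrite tofracB tofracM rmorph_nat -uX tofracXn; ring.
have [M M0 [m mT [p hp pM]]] := odd_cone_nat (@coneD false) (@coneM false)
  (@coneD true) (@coneM true) Psq N0 Tu h1 h2 h3.
exists m; split=> //; first by case: (m) mT.
(* Polynomials embed in their fractions, so [M] in the odd cone becomes a polynomial identity, and
   the positive integer [M] can be divided out. *)
have pE : p = M%:R *: f ^+ m.
  apply/eqP; rewrite -tofrac_eq -pM scaler_nat.
  by rewrite tofracMn tofracXn mulr_natl.
have -> : f ^+ m = M%:R^-1 *: p.
  by rewrite pE scalerA mulVf ?scale1r // pnatr_eq0 -lt0n.
by apply: sosZ => //; rewrite invr_ge0 ler0n.
Qed.

End PowerOfForm.

Theorem corollary4p7 (R : realType) (n : nat) (f : {mpoly R[n.+1]})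
  (f_form : is_form f) (f_pos : strictly_posdef f) :
  exists m : nat, [/\ odd m, (1 <= m)%N & sos_of_forms (f ^+ m)].
Proof.
have [d hd] := f_form.
have dE : d = d./2.*2.
  by rewrite -[LHS]odd_double_half (negPf (strictly_posdef_even hd f_pos)).
by rewrite dE in hd; exact: odd_power_sos hd f_pos.
Qed.
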